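(* Let $G$ be a commutative multiplicative hyperring with identity $1$, let $A$ be a $\mathcal{C}$-hyperideal of $G$ and let $S$ be a multiplicative closed subset of $G$ such that $A\cap S=\varnothing$. If $A$ is a weakly quasi $S$-primary hyperideal of $G$ and $\langle 0\rangle$ is a quasi $S$-primary $\mathcal{C}$-hyperideal of $G$, then $\mathrm{rad}(A)$ is an $S$-prime hyperideal of $G$.
   Context: A commutative multiplicative hyperring with identity is a triple $(G,+,\circ)$ where $(G,+)$ is an abelian group and $\circ$ assigns to each pair $(x,y)\in G\times G$ a non-empty subset $x\circ y\subseteq G$, such that for all $x,y,z\in G$: $(x\circ y)\circ z=x\circ(y\circ z)$; $(-x)\circ y=x\circ(-y)=-(x\circ y)$; $(y+z)\circ x\subseteq y\circ x+z\circ x$ and $x\circ(y+z)\subseteq x\circ y+x\circ z$; $x\circ y=y\circ x$; and there is $1\in G$ with $a\in 1\circ a$ for all $a\in G$. For non-empty subsets $X,Y\subseteq G$, $X\circ Y=\bigcup_{x\in X,y\in Y}x\circ y$ and $X+Y=\{x+y: x\in X,y\in Y\}$; elements are identified with singletons. A hyperideal of $G$ is a non-empty $A\subseteq G$ with $x-y\in A$ for all $x,y\in A$ and $r\circ x\subseteq A$ for all $x\in A$, $r\in G$. $\langle 0\rangle$ is the hyperideal generated by $0$ (the smallest hyperideal containing $0$). A proper hyperideal $P$ is prime if $x\circ y\subseteq P$ ($x,y\in G$) implies $x\in P$ or $y\in P$. $\mathrm{rad}(A)$ is the intersection of all prime hyperideals containing $A$, and $\mathrm{rad}(A)=G$ if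 there are none. $A$ is a $\mathcal{C}$-hyperideal if for all $n\in\mathbb{N}$ and $a_1,\dots,a_n\in G$, $(a_1\circ\cdots\circ a_n)\cap A\neq\varnothing$ implies $a_1\circ\cdots\circ a_n\subseteq A$. A multiplicative closed subset (MCS) of $G$ is a subset $S\subseteq G$ containing $1$ with $(s_1\circ s_2)\cap S\neq\varnothing$ for all $s_1,s_2\in S$. Let $A$ be a hyperideal with $A\cap S=\varnothing$. $A$ is $S$-prime if there is $t\in S$ such that for all $u,v\in G$, $u\circ v\subseteq A$ implies $t\circ u\subseteq A$ or $t\circ v\subseteq A$. $A$ is quasi $S$-primary if there is $t\in S$ such that for all $u,v\in G$, $u\circ v\subseteq A$ implies $t\circ u\subseteq \mathrm{rad}(A)$ or $t\circ v\subseteq\mathrm{rad}(A)$. $A$ is weakly quasi $S$-primary if there is $t\in S$ such that for all $u,v\in G$, if $0\notin u\circ v$ and $u\circ v\subseteq A$, then $t\circ u\subseteq \mathrm{rad}(A)$ or $t\circ v\subseteq\mathrm{rad}(A)$. *)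

(* Defs.v *)
From HB Require Import structures.
From mathcomp Require Import all_boot all_algebra.
From mathcomp Require Import boolp classical_sets.

Set Implicit Arguments.
Unset Strict Implicit.
Unset Printing Implicit Defensive.

Import GRing.Theory.
Local Open Scope classical_set_scope.
Local Open Scope ring_scope.

Definition hmul_lift (T : Type) (op : T -> T -> set T) (X Y : set T) : set T :=
  \bigcup_(x in X) \bigcup_(y in Y) op x y.

Definition set_add (G : zmodType) (X Y : set G) : set G :=
  [set x + y | x in X & y in Y].

(* The identity hone is a chosen element: a hyperring may have several
   elements e with a \in e o a for all a. Distributivity is an inclusion only,
   not an equality. *)
HB.mixin Record isComMulHyperring G of GRing.Zmodule G := {
  hmul : G -> G -> set G;
  hone : G;
  hmul_neq0 : forall x y, hmul x y !=set0;
  hmulA : forall x y z,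
    hmul_lift hmul (hmul x y) [set z] = hmul_lift hmul [set x] (hmul y z);
  hmulNl : forall x y, hmul (- x) y = [set - z | z in hmul x y];
  hmulNr : forall x y, hmul x (- y) = [set - z | z in hmul x y];
  hmulDl : forall x y z, hmul (y + z) x `<=` set_add (hmul y x) (hmul z x);
  hmulDr : forall x y z, hmul x (y + z) `<=` set_add (hmul x y) (hmul x z);
  hmulC : forall x y, hmul x y = hmul y x;
  hmul1 : forall a, hmul hone a a
}.

#[short(type="comMulHyperringType")]
HB.structure Definition ComMulHyperring :=
  { G of isComMulHyperring G & GRing.Zmodule G }.

Section Hyperideals.
Variable G : comMulHyperringType.
Implicit Types (A P S : set G) (x y u v t : G).

Definition hyperideal A : Prop :=
  [/\ A !=set0,
      forall x y, A x -> A y -> A (x - y)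
    & forall r x, A x -> hmul r x `<=` A].

Definition prime_hyperideal P : Prop :=
  [/\ hyperideal P,
      P <> [set: G]
    & forall x y, hmul x y `<=` P -> P x \/ P y].

(* The intersection over an empty family is [set: G], as required when no
   prime hyperideal contains A. *)
Definition hrad A : set G :=
  \bigcap_(P in [set P | prime_hyperideal P /\ A `<=` P]) P.

(* hprod a1 [:: a2; ...; an] is a1 o (a2 o ( ... o an)), with n >= 1. *)
Fixpoint hprod (x : G) (s : seq G) : set G :=
  if s is y :: s' then hmul_lift hmul [set x] (hprod y s') else [set x].

Definition C_hyperideal A : Prop :=
  hyperideal A /\
  forall (x : G) (s : seq G), hprod x s `&` A !=set0 -> hprod x s `<=` A.

Definition hzero : set G := smallest hyperideal [set 0].

Definition mcs S : Prop :=
  S hone /\ forall s1 s2, S s1 -> S s2 -> hmul s1 s2 `&` S !=set0.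

Definition S_prime S A : Prop :=
  [/\ hyperideal A,
      A `&` S = set0
    & exists2 t, S t & forall u v, hmul u v `<=` A ->
        hmul t u `<=` A \/ hmul t v `<=` A].

Definition quasi_S_primary S A : Prop :=
  [/\ hyperideal A,
      A `&` S = set0
    & exists2 t, S t & forall u v, hmul u v `<=` A ->
        hmul t u `<=` hrad A \/ hmul t v `<=` hrad A].

Definition weakly_quasi_S_primary S A : Prop :=
  [/\ hyperideal A,
      A `&` S = set0
    & exists2 t, S t & forall u v, ~ hmul u v 0 -> hmul u v `<=` A ->
        hmul t u `<=` hrad A \/ hmul t v `<=` hrad A].

End Hyperideals.

Arguments hzero G : clear implicits.

(* Main.v *)
Require Import Defs.
From mathcomp Require Import all_boot all_algebra.
From mathcomp Require Import boolp classical_sets.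

Local Open Scope classical_set_scope.

(** The radical of a C-hyperideal [A] behaves as in ordinary ring theory: [x]
    lies in [hrad A] iff some power of [x] is contained in [A] ([hrad_powP]).
    One direction is Krull's argument: if no power of [x] is contained in [A],
    the C-property makes all of them disjoint from [A], and a hyperideal maximal
    among those containing [A] and avoiding every power of [x] is prime
    ([prime_avoidance]). It follows that the C-property passes from [A] to
    [hrad A]: a finite product is inside [hrad A] as soon as it meets it
    ([hrad_prod_sub]).

    Suppose now that [u o v] is contained in [hrad A]. An element of [u o v] has
    a power contained in [A], hence [u^n o v^n] meets [A] for some [n], and is
    contained in [A]. Choose [a] in [u^n] and [b] in [v^n]. If [0] is not in
    [a o b], weak quasi S-primariness of [A] applies to [a] and [b]; otherwise
    [u^n o v^n] meets the zero hyperideal, so it is contained in it, and quasi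
    S-primariness of the zero hyperideal applies. Either way [t o a] or [t o b]
    is contained in [hrad A], where [t] is one of the two elements of [S]
    provided by the hypotheses. Say [t o a] is: then [t o u^n] meets [hrad A],
    so it is contained in it, and therefore [t o u] is too ([hrad_mul_setpow]).
    An element of [S] in the product of the two witnesses serves for both cases
    at once. *)

Import GRing.Theory.

Set Implicit Arguments.
Unset Strict Implicit.

(** * Products and powers of subsets *)

Section SetProducts.
Variable G : comMulHyperringType.
Implicit Types (X Y Z A : set G) (x y : G) (s : seq G).

Local Notation "X ** Y" := (hmul_lift (@hmul G) X Y)
  (at level 40, left associativity).

Lemma setmulP X Y z :
  (X ** Y) z <-> exists x y, [/\ X x, Y y & hmul x y z].
Proof.
split=> [[x Xx [y Yy xyz]]|[x [y [Xx Yy xyz]]]]; first by exists x, y.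
by exists x => //; exists y.
Qed.

Lemma setmul1 x y : [set x] ** [set y] = hmul x y.
Proof.
apply/seteqP; split=> [z /setmulP[? [? [-> ->]]] //|z xyz].
by apply/setmulP; exists x, y.
Qed.

Lemma setmulS X X' Y Y' : X `<=` X' -> Y `<=` Y' -> X ** Y `<=` X' ** Y'.
Proof.
move=> sX sY z /setmulP[x [y [Xx Yy xyz]]].
by apply/setmulP; exists x, y; split; [exact: sX|exact: sY|].
Qed.

Lemma setmulC X Y : X ** Y = Y ** X.
Proof.
by apply/seteqP; split=> z /setmulP[x [y [Xx Yy xyz]]]; apply/setmulP;
  exists y, x; rewrite hmulC.
Qed.

Lemma setmulA X Y Z : X ** Y ** Z = X ** (Y ** Z).
Proof.
apply/seteqP; split=> w /setmulP.
  move=> [p [z [/setmulP[x [y [Xx Yy xyp]]] Zz pzw]]].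
  have : (hmul x y ** [set z]) w by apply/setmulP; exists p, z.
  rewrite hmulA => /setmulP[? [q [-> yzq xqw]]].
  by apply/setmulP; exists x, q; split=> //; apply/setmulP; exists y, z.
move=> [x [q [Xx /setmulP[y [z [Yy Zz yzq]]] xqw]]].
have : ([set x] ** hmul y z) w by apply/setmulP; exists x, q.
rewrite -hmulA => /setmulP[p [? [xyp -> pzw]]].
by apply/setmulP; exists p, z; split=> //; apply/setmulP; exists x, y.
Qed.

Lemma setmulACA X Y Z T : X ** Y ** (Z ** T) = X ** Z ** (Y ** T).
Proof. by rewrite !setmulA -(setmulA Y) (setmulC Y Z) (setmulA Z). Qed.

Lemma setmul_neq0 X Y : X !=set0 -> Y !=set0 -> X ** Y !=set0.
Proof.
move=> [x Xx] [y Yy]; have [z xyz] := hmul_neq0 x y.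
by exists z; apply/setmulP; exists x, y.
Qed.

(** [setpow X n] is the power of exponent [n.+1]. The exponent is shifted
    because the singleton of [hone] is not neutral for the product of sets, so
    that there is no good candidate for the power of exponent zero. *)
Fixpoint setpow X n : set G := if n is n'.+1 then X ** setpow X n' else X.

Lemma setpowS X Y n : X `<=` Y -> setpow X n `<=` setpow Y n.
Proof. by move=> sXY; elim: n => //= n IHn; exact: setmulS. Qed.

Lemma setpowM X Y n : setpow (X ** Y) n = setpow X n ** setpow Y n.
Proof. by elim: n => //= n ->; exact: setmulACA. Qed.

Lemma setpowD X m n : setpow X m ** setpow X n = setpow X (m + n).+1.
Proof. by elim: m => //= m IHm; rewrite setmulA IHm. Qed.

Lemma setpow_neq0 X n : X !=set0 -> setpow X n !=set0.
Proof. by move=> X0; elim: n => //= n; exact: setmul_neq0. Qed.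

Definition finite_product X := exists x s, X = hprod x s.

Lemma finite_product1 x : finite_product [set x].
Proof. by exists x, [::]. Qed.

Lemma finite_productM X Y :
  finite_product X -> finite_product Y -> finite_product (X ** Y).
Proof.
move=> [x [s ->]] [y [t ->]]; exists x, (s ++ y :: t).
by elim: s x => //= z s IHs x; rewrite -IHs setmulA.
Qed.

Lemma finite_product_pow X n : finite_product X -> finite_product (setpow X n).
Proof. by move=> pX; elim: n => //= n; exact: finite_productM. Qed.

Lemma C_hyperideal_prod_sub {A X} :
  C_hyperideal A -> finite_product X -> X `&` A !=set0 -> X `<=` A.
Proof. by move=> [_ cA] [x [s ->]]; exact: cA. Qed.

Lemma mcs_setpow (S : set G) x n :
  mcs S -> S x -> setpow [set x] n `&` S !=set0.
Proof.
move=> [_ mS] Sx; elim: n => [|n [y [xny Sy]]] /=; first by exists x.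
have [z [xyz Sz]] := mS _ _ Sx Sy.
by exists z; split=> //; apply/setmulP; exists x, y.
Qed.

(** * Hyperideals and prime avoidance *)

Lemma hyperideal0 {A} : hyperideal A -> A 0%R.
Proof. by move=> [[x Ax] subA _]; rewrite -(subrr x); exact: subA. Qed.

Lemma hyperidealMl A X Y : hyperideal A -> X `<=` A -> Y ** X `<=` A.
Proof.
by move=> [_ _ mulA] sXA z /setmulP[y [x [_ /sXA Ax yxz]]]; exact: mulA yxz.
Qed.

Lemma hyperideal_bigcap (F : set (set G)) :
  (forall A, F A -> hyperideal A) -> hyperideal (\bigcap_(A in F) A).
Proof.
move=> idF; split.
- by exists 0%R => A /idF/hyperideal0.
- by move=> x y Ix Iy A FA; have [_ subA _] := idF _ FA; apply: subA;
    [exact: Ix|exact: Iy].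
- by move=> r x Ix z rxz A FA; have [_ _ mulA] := idF _ FA;
    apply: mulA rxz; exact: Ix.
Qed.

Lemma hyperideal_smallest X : hyperideal (smallest (@hyperideal G) X).
Proof. by apply: hyperideal_bigcap => A []. Qed.

Lemma hyperideal_hrad A : hyperideal (hrad A).
Proof. by apply: hyperideal_bigcap => P [[]]. Qed.

Lemma hrad_subset A B : A `<=` B -> hrad A `<=` hrad B.
Proof.
by move=> sAB x Ax P [pP sBP]; apply: Ax; split=> //; exact: subset_trans sBP.
Qed.

Lemma hzero_sub A : hyperideal A -> hzero G `<=` A.
Proof.
by move=> idA; apply: smallest_sub => // _ ->; exact: hyperideal0.
Qed.

Definition colon P Y : set G := [set x | forall y, Y y -> hmul x y `<=` P].

Lemma hyperideal_colon P Y : hyperideal P -> hyperideal (colon P Y).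
Proof.
move=> idP; have [_ subP mulP] := idP; split.
- by exists 0%R => y _; rewrite hmulC; apply: mulP; exact: hyperideal0.
- move=> x x' Px Px' y Yy z /hmulDl[a xya [b]].
  by rewrite hmulNl => -[c x'yc <-] <-; apply: subP;
    [exact: Px xya|exact: Px' x'yc].
- move=> r x Px w rxw y Yy z wyz.
  have : (hmul r x ** [set y]) z by apply/setmulP; exists w, y.
  by rewrite hmulA; apply: hyperidealMl => //; exact: Px.
Qed.

Lemma sub_colon P Y : hyperideal P -> P `<=` colon P Y.
Proof. by move=> [_ _ mulP] x Px y _; rewrite hmulC; exact: mulP. Qed.

(** Two applications of the colon hyperideal, one for each factor, avoid any
    description of the generated hyperideals by finite sums, which inclusion
    distributivity makes awkward. *)
Lemma mul_generated_sub P u v : hyperideal P -> hmul u v `<=` P ->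
  smallest (@hyperideal G) (P `|` [set u])
    ** smallest (@hyperideal G) (P `|` [set v]) `<=` P.
Proof.
move=> idP uvP; set J := smallest (@hyperideal G) (P `|` [set u]).
have Jv : J `<=` colon P [set v].
  apply: smallest_sub; first exact: hyperideal_colon.
  by move=> x [|->]; [exact: sub_colon|move=> _ ->].
have vJ : smallest (@hyperideal G) (P `|` [set v]) `<=` colon P J.
  apply: smallest_sub; first exact: hyperideal_colon.
  move=> x [|->]; first exact: sub_colon.
  by move=> y /Jv yv; rewrite hmulC; exact: yv.
by move=> z /setmulP[x [y [Jx /vJ Py]]]; rewrite hmulC; exact: Py.
Qed.

Lemma exists_maximal_avoiding A T : hyperideal A -> A `&` T = set0 ->
  exists P, [/\ hyperideal P, A `<=` P, P `&` T = set0 &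
    forall J, hyperideal J -> P `<=` J -> J `&` T = set0 -> J `<=` P].
Proof.
move=> idA A0.
(* Joining [A] to each member lets the empty chain be treated like the others:
   its union is then [A] instead of the empty set. *)
pose Q X := hyperideal (A `|` X) /\ (A `|` X) `&` T = set0.
have [F FQ totF|X [[idX X0] maxX]] := @Zorn_bigcup G Q.
  have [_ subA mulA] := idA.
  split; last first.
    apply/seteqP; split=> // x [[Ax|[X FX Xx]] Tx]; first by rewrite -A0.
    by have [_ <-] := FQ _ FX; split=> //; right.
  have FU X : F X -> A `|` X `<=` A `|` \bigcup_(Y in F) Y.
    by move=> FX x [|Xx]; [left|right; exists X].
  (* Any two elements of the union lie in one member, or in [A]. *)
  have pairU x y : (A `|` \bigcup_(Y in F) Y) x ->
      (A `|` \bigcup_(Y in F) Y) y ->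
      (A x /\ A y) \/ exists X, [/\ F X, (A `|` X) x & (A `|` X) y].
    move=> [Ax|[X FX Xx]] [Ay|[Y FY Yy]]; first by left.
    - by right; exists Y; split=> //; [left|right].
    - by right; exists X; split=> //; [right|left].
    - right; case: (totF _ _ FX FY) => sub.
        by exists Y; split=> //; right=> //; exact: sub.
      by exists X; split=> //; right=> //; exact: sub.
  split.
  - by exists 0%R; left; exact: hyperideal0.
  - move=> x y Ux Uy; have [[Ax Ay]|[X [FX Xx Xy]]] := pairU _ _ Ux Uy.
      by left; exact: subA.
    by have [[_ subX _] _] := FQ _ FX; apply: (FU X) => //; exact: subX.
  - move=> r x Ux z rxz; have [[Ax _]|[X [FX Xx _]]] := pairU _ _ Ux Ux.
      by left; exact: mulA rxz.
    by have [[_ _ mulX] _] := FQ _ FX; apply: (FU X) => //; exact: mulX rxz.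
exists (A `|` X); split=> //.
move=> J idJ sXJ J0.
have AJ : A `|` J = J by apply/setUidPr; apply: subset_trans sXJ; left.
have [sJX|nJX] := pselect (J `<=` X); first by apply: subset_trans sJX _; right.
exfalso; apply: (maxX J); last by rewrite /Q AJ.
split=> //; apply: subset_trans sXJ.
exact: subsetUr.
Qed.

(** Krull's lemma: if neither [u] nor [v] is in the maximal [P], both
    hyperideals generated by [P] and one of them meet [T]; so does their
    product, which is contained in [P] when [u o v] is. *)
Lemma prime_avoidance A T : hyperideal A -> A `&` T = set0 ->
  T !=set0 -> T ** T `<=` T ->
  exists P, [/\ prime_hyperideal P, A `<=` P & P `&` T = set0].
Proof.
move=> idA A0 [t Tt] mT.
have [P [idP sAP P0 maxP]] := exists_maximal_avoiding idA A0.
exists P; split=> //; split=> //.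
  move=> PG; suff : (P `&` T) t by rewrite P0.
  by split=> //; rewrite PG.
have meets u : ~ P u -> smallest (@hyperideal G) (P `|` [set u]) `&` T !=set0.
  move=> nPu; apply/set0P/eqP => J0; apply: nPu.
  have sub : P `|` [set u] `<=` smallest (@hyperideal G) (P `|` [set u]).
    exact: sub_smallest.
  apply: (maxP _ _ _ J0); first exact: hyperideal_smallest.
    by move=> x Px; apply: sub; left.
  by apply: sub; right.
move=> u v uvP.
have [Pu|/meets[x [Jx Tx]]] := pselect (P u); first by left.
have [Pv|/meets[y [Jy Ty]]] := pselect (P v); first by right.
have [z xyz] := hmul_neq0 x y.
suff : (P `&` T) z by rewrite P0.
split; last by apply: mT; apply/setmulP; exists x, y.
by apply: (mul_generated_sub idP uvP); apply/setmulP; exists x, y.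
Qed.

(** * Radicals of C-hyperideals *)

Lemma prime_setpow P x n :
  prime_hyperideal P -> setpow [set x] n `<=` P -> P x.
Proof.
move=> [_ _ primeP]; elim: n => [|n IHn] /= xnP; first exact: xnP.
have [//|nPx] := pselect (P x); apply: IHn => y xny.
have [z xyz||//] := primeP x y; last by move/nPx.
by apply: xnP; apply/setmulP; exists x, y.
Qed.

Lemma hrad_setpow A x n : setpow [set x] n `<=` hrad A -> hrad A x.
Proof.
move=> xnR P [pP sAP]; apply: (prime_setpow pP) => y /xnR; exact.
Qed.

Lemma sub_hrad A : A `<=` hrad A.
Proof. by move=> x Ax P [_]; exact. Qed.

(** The C-property turns the failure of [x^n] to be contained in [A] into
    disjointness, which is what prime avoidance requires. *)
Lemma hrad_powP A x : C_hyperideal A ->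
  hrad A x <-> exists n, setpow [set x] n `<=` A.
Proof.
move=> cA; split=> [Rx|[n xnA]]; last first.
  by apply: (@hrad_setpow _ _ n); apply: subset_trans xnA _; exact: sub_hrad.
apply: contrapT => nA; pose T := \bigcup_n setpow [set x] n.
have Tx : T x by exists 0%N.
have A0 : A `&` T = set0.
  apply/seteqP; split=> // y [Ay [n _ xny]]; apply: nA; exists n.
  apply: (C_hyperideal_prod_sub cA); last by exists y.
  by apply: finite_product_pow; exact: finite_product1.
have [||P [pP sAP P0]] := prime_avoidance cA.1 A0; first by exists x.
  move=> z /setmulP[y [y' [[m _ xmy] [n _ xny] yz]]]; exists (m + n).+1 => //.
  by rewrite -setpowD; apply/setmulP; exists y, y'.
suff : (P `&` T) x by rewrite P0.
by split=> //; exact: Rx.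
Qed.

(** If [w] is in [X] and [w^n] is contained in [A], the product [X^n] meets [A],
    so it is contained in [A], and with it the [n]th power of every element
    of [X]. *)
Lemma hrad_prod_sub A X : C_hyperideal A -> finite_product X ->
  X `&` hrad A !=set0 -> X `<=` hrad A.
Proof.
move=> cA pX [w [Xw /(hrad_powP _ cA)[n wnA]]] y Xy.
apply/(hrad_powP _ cA); exists n.
have sub1 z : X z -> setpow [set z] n `<=` setpow X n.
  by move=> Xz; apply: setpowS => _ ->.
apply: subset_trans (sub1 _ Xy) _.
apply: (C_hyperideal_prod_sub cA); first exact: finite_product_pow.
have [z wnz] : setpow [set w] n !=set0 by apply: setpow_neq0; exists w.
by exists z; split; [exact: sub1 wnz|exact: wnA].
Qed.

Lemma hrad_mul_setpow A t u a n : C_hyperideal A ->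
  setpow [set u] n a -> hmul t a `<=` hrad A -> hmul t u `<=` hrad A.
Proof.
move=> cA una taR.
have tunR : [set t] ** setpow [set u] n `<=` hrad A.
  apply: hrad_prod_sub => //.
    apply: finite_productM; first exact: finite_product1.
    by apply: finite_product_pow; exact: finite_product1.
  have [z taz] := hmul_neq0 t a; exists z; split; last exact: taR.
  by apply/setmulP; exists t, a.
move=> y tuy; apply: (@hrad_setpow _ _ n).
have : setpow [set y] n `<=` setpow ([set t] ** [set u]) n.
  by apply: setpowS => _ ->; rewrite setmul1.
move=> /subset_trans; apply; rewrite setpowM.
(* The surplus factors [t] are absorbed by the hyperideal [hrad A]. *)
case: n {una} tunR => [|n] tunR //=.
rewrite (setmulC [set t]) setmulA.
by apply: hyperidealMl => //; exact: hyperideal_hrad.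
Qed.

Lemma mul_setpow_sub A u v : C_hyperideal A -> hmul u v `<=` hrad A ->
  exists n, setpow [set u] n ** setpow [set v] n `<=` A.
Proof.
move=> cA uvR; have [w uvw] := hmul_neq0 u v.
have /(hrad_powP _ cA)[n wnA] := uvR _ uvw; exists n.
have [z wnz] : setpow [set w] n !=set0 by apply: setpow_neq0; exists w.
rewrite -setpowM setmul1; apply: (C_hyperideal_prod_sub cA).
  apply: finite_product_pow; rewrite -setmul1.
  by apply: finite_productM; exact: finite_product1.
exists z; split; last exact: wnA.
by apply: setpowS wnz => _ ->.
Qed.

Lemma hrad_disjoint_mcs A (S : set G) :
  C_hyperideal A -> mcs S -> A `&` S = set0 -> hrad A `&` S = set0.
Proof.
move=> cA mS A0; apply/seteqP; split=> // s [/(hrad_powP _ cA)[n snA] Ss].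
have [z [snz Sz]] := mcs_setpow n mS Ss.
suff : (A `&` S) z by rewrite A0.
by split=> //; exact: snA.
Qed.

Lemma mul_hyperideal_sub A t1 t2 t u : hyperideal A -> hmul t1 t2 t ->
  hmul t1 u `<=` A \/ hmul t2 u `<=` A -> hmul t u `<=` A.
Proof.
move=> idA t12t t12u z tuz.
have : (hmul t1 t2 ** [set u]) z by apply/setmulP; exists t, u.
case: t12u => sub.
  by rewrite (hmulC t1) hmulA; exact: hyperidealMl.
by rewrite hmulA; exact: hyperidealMl.
Qed.

End SetProducts.

Unset Implicit Arguments.

Theorem theorem3p3 (G : comMulHyperringType) (A S : set G)
  (hAC : C_hyperideal A) (hS : mcs S) (hAS : A `&` S = set0)
  (hA : weakly_quasi_S_primary S A)
  (h0 : quasi_S_primary S (hzero G)) (h0C : C_hyperideal (hzero G)) :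
  S_prime S (hrad A).
Proof.
have [idA _ [t1 St1 wA]] := hA.
have [_ _ [t2 St2 q0]] := h0.
split; [exact: hyperideal_hrad|exact: hrad_disjoint_mcs|].
have [t [t12t St]] := hS.2 _ _ St1 St2.
exists t => // u v /(mul_setpow_sub hAC)[n uvnA].
have pow1 x : finite_product (setpow [set x] n).
  by apply: finite_product_pow; exact: finite_product1.
have [a una] : setpow [set u] n !=set0 by apply: setpow_neq0; exists u.
have [b vnb] : setpow [set v] n !=set0 by apply: setpow_neq0; exists v.
have abuv : hmul a b `<=` hmul_lift hmul (setpow [set u] n) (setpow [set v] n).
  by move=> z abz; apply/setmulP; exists a, b.
have idR := hyperideal_hrad A.
have [ab0|nab0] := pselect (hmul a b 0%R); last first.
  have [t1a|t1b] := wA _ _ nab0 (subset_trans abuv uvnA).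
    left; apply: mul_hyperideal_sub idR t12t _; left.
    exact: hrad_mul_setpow una t1a.
  right; apply: mul_hyperideal_sub idR t12t _; left.
  exact: hrad_mul_setpow vnb t1b.
have uvn0 : hmul_lift hmul (setpow [set u] n) (setpow [set v] n) `<=` hzero G.
  apply: (C_hyperideal_prod_sub h0C); first exact: finite_productM.
  by exists 0%R; split; [exact: abuv|exact: hyperideal0 h0C.1].
have rad0A := hrad_subset (hzero_sub idA).
have [t2a|t2b] := q0 _ _ (subset_trans abuv uvn0).
  left; apply: mul_hyperideal_sub idR t12t _; right.
  exact: hrad_mul_setpow una (subset_trans t2a rad0A).
right; apply: mul_hyperideal_sub idR t12t _; right.
exact: hrad_mul_setpow vnb (subset_trans t2b rad0A).
Qed.
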